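(* Let $k$ be a field of characteristic $0$, $n\ge 2$, and let $v$ be a discrete valuation of $K_n=k((X_1,\ldots,X_n))$ over $k$ (in the sense of the context) with value group $\mathbb{Z}$. Then, by applying a finite number of monoidal transformations and changes of coordinates (and permutations of variables) to $X_1,\ldots,X_n$, one obtains new variables among which there is an element $Y_1$ with $\hat v(Y_1)=1$.
   Context: $R_n=k[[X_1,\ldots,X_n]]$, $M_n=(X_1,\ldots,X_n)$, $K_n$ its quotient field. A discrete valuation of $K_n\mid k$ is a rank-one discrete valuation trivial on $k$ with center $M_n$ in $R_n$. $\widehat K_n$ is the completion of $K_n$ with respect to $v$, $\hat v$ the extension of $v$, $R_{\hat v}$ its valuation ring with maximal ideal $\mathfrak m_{\hat v}$. Monoidal transformation: $k[[X_1,\ldots,X_n]]\to k[[Y_1,\ldots,Y_n]]$, $X_1\mapsto Y_1$, $X_2\mapsto Y_1Y_2$, $X_i\mapsto Y_i$ ($i\ge3$), used when $v(X_2)>v(X_1)$. Change of coordinates: $k[[X_1,\ldots,X_n]]\to L[[Y_1,\ldots,Y_n]]$, $X_1\mapsto Y_1$, $X_i\mapsto Y_i+c_iY_1$ ($i\ge 2$), where $c_i\in R_{\hat v}\setminus\mathfrak m_{\hat v}$ and $L$ is an extension field of $k$. In both cases the new variables $Y_i$ are regarded as elements of $R_{\hat v}\subset \widehat K_n$ (e.g. $Y_i=X_i-c_iX_1$), and transformations may be composed finitely many times. *)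

(* Defs.v *)
From HB Require Import structures.
From mathcomp Require Import all_boot all_order all_algebra all_fingroup.
Set Implicit Arguments. Unset Strict Implicit. Unset Printing Implicit Defensive.
Import Order.TTheory GRing.Theory Num.Theory.
Local Open Scope ring_scope.

(* Multi-indices (exponent vectors) in n variables, and formal power series
   k[[X_1,...,X_n]] given by their coefficient functions. *)
Definition mono (n : nat) := {ffun 'I_n -> nat}.
Definition pseries (n : nat) (k : Type) := mono n -> k.

Definition mono0 (n : nat) : mono n := [ffun => 0%N].

Section Defs.
Variables (k F : fieldType) (n : nat).

(* "y = 0 or w y >= N"; w is only meaningful on nonzero elements
   (w 0 = +oo by convention). *)
Definition vge (w : F -> int) (y : F) (N : int) : Prop := y = 0 \/ N <= w y.

Definition is_valuation (w : F -> int) : Prop :=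
  (forall x y : F, x != 0 -> y != 0 -> w (x * y) = w x + w y) /\
  (forall x y : F, x != 0 -> y != 0 -> x + y != 0 ->
     Num.min (w x) (w y) <= w (x + y)).

Definition converges_to (w : F -> int) (u : nat -> F) (l : F) : Prop :=
  forall N : int, exists M : nat, forall p, (M <= p)%N -> vge w (u p - l) N.

Definition cauchy (w : F -> int) (u : nat -> F) : Prop :=
  forall N : int, exists M : nat, forall p q, (M <= p)%N -> (M <= q)%N ->
    vge w (u p - u q) N.

Definition complete (w : F -> int) : Prop :=
  forall u, cauchy w u -> exists l, converges_to w u l.

Definition ps_partial (emb : k -> F) (xs : 'I_n -> F) (f : pseries n k)
    (d : nat) : F :=
  \sum_(a : {ffun 'I_n -> 'I_d.+1})
     emb (f [ffun i => nat_of_ord (a i)]) * \prod_(i < n) xs i ^+ a i.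

Definition subfield_of (L : F -> Prop) : Prop :=
  L 0 /\ L 1 /\
  (forall x y, L x -> L y -> L (x - y) /\ L (x * y)) /\
  (forall x, L x -> x != 0 -> L x^-1).

(* One transformation step.  A state is (L, Y): the current coefficient
   field L (a subfield of R_{\hat v} containing k) and the current variables
   Y_1..Y_n, regarded as elements of \hat K_n.
   - Monoidal: Y_j |-> Y_j / Y_i when \hat v(Y_j) > \hat v(Y_i)
     (the paper's case i = 1, j = 2 up to permutation of variables).
   - CoordChange: Y_j |-> Y_j - c_j Y_i (j <> i), c_j in R_{\hat v} \ m_{\hat v},
     c_j in an extension field L' of L inside R_{\hat v}.
   - Permute: permutation of the variables. *)
Inductive transf_step (w : F -> int) :
    (F -> Prop) -> ('I_n -> F) -> (F -> Prop) -> ('I_n -> F) -> Prop :=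
| Monoidal L Y (i j : 'I_n) :
    i != j -> Y i != 0 -> Y j != 0 -> w (Y i) < w (Y j) ->
    transf_step w L Y L (fun l => if l == j then Y j / Y i else Y l)
| CoordChange L L' Y (i : 'I_n) (c : 'I_n -> F) :
    subfield_of L' -> (forall x, L x -> L' x) ->
    (forall x, L' x -> x != 0 -> 0 <= w x) ->
    (forall j, j != i -> [/\ L' (c j), c j != 0 & w (c j) = 0]) ->
    transf_step w L Y L' (fun l => if l == i then Y i else Y l - c l * Y i)
| Permute L Y (s : {perm 'I_n}) :
    transf_step w L Y L (fun l => Y (s l)).

Inductive reachable (w : F -> int) :
    (F -> Prop) -> ('I_n -> F) -> (F -> Prop) -> ('I_n -> F) -> Prop :=
| reach_refl L Y : reachable w L Y L Y
| reach_step L Y L1 Y1 L2 Y2 :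
    transf_step w L Y L1 Y1 -> reachable w L1 Y1 L2 Y2 ->
    reachable w L Y L2 Y2.

End Defs.

(* Main.v *)
Require Import Defs.
From HB Require Import structures.
From mathcomp Require Import all_boot all_order all_algebra all_fingroup.
From mathcomp Require Import boolp classical_sets.
From mathcomp Require Import zify ring.
Set Implicit Arguments. Unset Strict Implicit. Unset Printing Implicit Defensive.
Import Order.TTheory GRing.Theory Num.Theory.
Local Open Scope ring_scope.

(* Zorn's lemma gives a subfield [L] of the valuation ring that contains [k]
   and is maximal; by Hensel's lemma in characteristic 0 it represents every
   residue class.  Among all variables of all states reachable with coefficient
   field [L], take one, [t], of minimal value.  Any other variable of the same
   state can be divided by [t] as long as its value exceeds [w t], and an
   [L]-multiple of [t] can be subtracted when the values agree; minimality of
   [w t] means that this never stops, so every variable lies in [L[[t]]].  Hence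
   so do the original variables and all of [k[[X]]], whose values are therefore
   multiples of [w t].  As the value group is [Z], [w t = 1]. *)

(** * Ultrametric estimates, with zero counted as having infinite value *)

Section Valuation.
Variables (F : fieldType) (w : F -> int).
Hypothesis wP : is_valuation w.

Lemma valM x y : x != 0 -> y != 0 -> w (x * y) = w x + w y.
Proof. exact: wP.1. Qed.

Lemma val1 : w 1 = 0.
Proof. by have := @valM 1 1 (oner_neq0 _) (oner_neq0 _); rewrite mulr1; lia. Qed.

Lemma valN x : w (- x) = w x.
Proof.
have [->|x0] := eqVneq x 0; first by rewrite oppr0.
have N10 : (-1 : F) != 0 by rewrite oppr_eq0 oner_neq0.
have := valM N10 N10; rewrite mulrNN mulr1 val1 => h.
by rewrite -mulN1r valM //; lia.
Qed.

Lemma valV x : x != 0 -> w x^-1 = - w x.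
Proof.
move=> x0; have := @valM x x^-1 x0; rewrite invr_eq0 => /(_ x0).
by rewrite divff // val1; lia.
Qed.

Lemma vge_weaken M N x : N <= M -> vge w x M -> vge w x N.
Proof. by move=> NM [->|h]; [left|right; lia]. Qed.

Lemma vgeD x y N : vge w x N -> vge w y N -> vge w (x + y) N.
Proof.
have [->|x0] := eqVneq x 0; first by rewrite add0r.
have [->|y0] := eqVneq y 0; first by rewrite addr0.
case=> [/eqP|hx]; first by rewrite (negPf x0).
case=> [/eqP|hy]; first by rewrite (negPf y0).
have [->|xy0] := eqVneq (x + y) 0; first by left.
by right; apply: le_trans (wP.2 _ _ x0 y0 xy0); rewrite le_min hx.
Qed.

Lemma vgeN x N : vge w x N -> vge w (- x) N.
Proof. by case=> [->|h]; [rewrite oppr0; left|right; rewrite valN]. Qed.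

Lemma vgeB x y N : vge w x N -> vge w y N -> vge w (x - y) N.
Proof. by move=> hx /vgeN; apply: vgeD. Qed.

Lemma vgeBC x y N : vge w (x - y) N -> vge w (y - x) N.
Proof. by move/vgeN; rewrite opprB. Qed.

Lemma vgeB_trans y x z N :
  vge w (x - y) N -> vge w (y - z) N -> vge w (x - z) N.
Proof. by move=> h /(vgeD h); rewrite addrA subrK. Qed.

Lemma vgeM x y M N : vge w x M -> vge w y N -> vge w (x * y) (M + N).
Proof.
have [->|x0] := eqVneq x 0; first by rewrite mul0r; left.
have [->|y0] := eqVneq y 0; first by rewrite mulr0; left.
case=> [/eqP|hx]; first by rewrite (negPf x0).
case=> [/eqP|hy]; first by rewrite (negPf y0).
by right; rewrite valM // lerD.
Qed.

Lemma vgeMl x y N : vge w x 0 -> vge w y N -> vge w (x * y) N.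
Proof. by move=> hx /(vgeM hx); rewrite add0r. Qed.

Lemma vge_eq0 x : (forall N, vge w x N) -> x = 0.
Proof. by move=> /(_ (w x + 1)) [//|]; lia. Qed.

Lemma vge_neq0 x N : x != 0 -> vge w x N -> N <= w x.
Proof. by move=> x0 [/eqP|//]; rewrite (negPf x0). Qed.

(** Equality case of the ultrametric inequality: a value of [y] above [w x] would force
    [x = y + (x - y)] above [w x] as well. *)
Lemma val_dominant x y : x != 0 -> vge w (x - y) (w x + 1) ->
  y != 0 /\ w y = w x.
Proof.
move=> x0 h.
have y0 : y != 0.
  apply/eqP => y0; move: h; rewrite y0 subr0 => /(vge_neq0 x0); lia.
split=> //.
have h1 : vge w (x - (x - y)) (w x).
  by apply: vgeB; [right|apply: vge_weaken h; lia].
have h2 : ~~ (w x < w y).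
  apply/negP => lt; have : vge w (y + (x - y)) (w x + 1).
    by apply: vgeD => //; right; lia.
  by rewrite addrC subrK => /(vge_neq0 x0); lia.
by move: h1; rewrite opprB addrC subrK => /(vge_neq0 y0); lia.
Qed.

Lemma converges_to_unique u l l' :
  converges_to w u l -> converges_to w u l' -> l = l'.
Proof.
move=> ul ul'; apply/eqP; rewrite -subr_eq0; apply/eqP/vge_eq0 => N.
have [m hm] := ul N; have [m' hm'] := ul' N.
apply: (@vgeB_trans (u (maxn m m'))); last by apply: hm'; lia.
by apply: vgeBC; apply: hm; lia.
Qed.

End Valuation.

(** * Polynomials with restricted coefficients, and simple field extensions *)

Section CoefIn.
Variables (F : fieldType) (L : F -> Prop).
Implicit Types p q : {poly F}.

(** Used both for a subfield and, with [vge w ^~ 0], for the valuation ring. *)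
Definition coef_in p := forall i, L p`_i.

Lemma coef_in_cons p c : coef_in (p * 'X + c%:P) -> coef_in p /\ L c.
Proof.
rewrite -cons_poly_def => h; split=> [i|].
  by have := h i.+1; rewrite coef_cons.
by have := h 0%N; rewrite coef_cons.
Qed.

Hypothesis LP : subfield_of L.

Lemma subfield0 : L 0. Proof. exact: LP.1. Qed.
Lemma subfield1 : L 1. Proof. exact: LP.2.1. Qed.
Lemma subfieldB x y : L x -> L y -> L (x - y).
Proof. by move=> hx hy; have [] := LP.2.2.1 _ _ hx hy. Qed.
Lemma subfieldM x y : L x -> L y -> L (x * y).
Proof. by move=> hx hy; have [] := LP.2.2.1 _ _ hx hy. Qed.
Lemma subfieldN x : L x -> L (- x).
Proof. by rewrite -sub0r; apply: subfieldB; apply: subfield0. Qed.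
Lemma subfieldD x y : L x -> L y -> L (x + y).
Proof. by move=> hx /subfieldN; rewrite -{2}[y]opprK; apply: subfieldB. Qed.
Lemma subfieldV x : L x -> L x^-1.
Proof.
have [->|x0 hx] := eqVneq x 0; first by rewrite invr0.
exact: LP.2.2.2.
Qed.
Lemma subfield_nat m : L m%:R.
Proof.
by elim: m => [|m IH]; [apply: subfield0|rewrite mulrS; apply: subfieldD subfield1 _].
Qed.

Lemma coef_inC c : L c -> coef_in c%:P.
Proof. by move=> hc i; rewrite coefC; case: ifP => // _; apply: subfield0. Qed.

Lemma coef_inX : coef_in 'X.
Proof. by move=> i; rewrite coefX; apply: subfield_nat. Qed.

Lemma coef_inB p q : coef_in p -> coef_in q -> coef_in (p - q).
Proof. by move=> hp hq i; rewrite coefB; apply: subfieldB. Qed.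

Lemma coef_inD p q : coef_in p -> coef_in q -> coef_in (p + q).
Proof. by move=> hp hq i; rewrite coefD; apply: subfieldD. Qed.

Lemma coef_inM p q : coef_in p -> coef_in q -> coef_in (p * q).
Proof.
move=> hp hq i; rewrite coefM; elim/big_ind: _; first exact: subfield0.
  exact: subfieldD.
by move=> j _; apply: subfieldM.
Qed.

Lemma coef_in_Xn m : coef_in 'X^m.
Proof. by move=> i; rewrite coefXn; apply: subfield_nat. Qed.

Lemma coef_in_deriv p : coef_in p -> coef_in p^`().
Proof.
move=> hp i; rewrite coef_deriv -mulr_natr.
by apply: subfieldM => //; apply: subfield_nat.
Qed.

(** The simple extension [L(e)], for algebraic and transcendental [e] alike. *)
Definition adjoin e x :=
  exists p q, [/\ coef_in p, coef_in q, q.[e] != 0 & x = p.[e] / q.[e]].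

Lemma adjoin_base e x : L x -> adjoin e x.
Proof.
move=> hx; exists x%:P, 1; split; [exact: coef_inC| | |].
- exact: coef_inC subfield1.
- by rewrite hornerE oner_neq0.
- by rewrite !hornerE invr1 mulr1.
Qed.

Lemma adjoin_gen e : adjoin e e.
Proof.
exists 'X, 1; split; [exact: coef_inX| | |].
- exact: coef_inC subfield1.
- by rewrite hornerE oner_neq0.
- by rewrite !hornerE invr1 mulr1.
Qed.

Lemma adjoin_subfield e : subfield_of (adjoin e).
Proof.
split; [exact/adjoin_base/subfield0|split; [exact/adjoin_base/subfield1|]].
split=> [_ _ [p [q [hp hq q0 ->]]] [p' [q' [hp' hq' q'0 ->]]]|].
  split.
    exists (p * q' - p' * q), (q * q'); split.
    - by apply: coef_inB; apply: coef_inM.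
    - exact: coef_inM.
    - by rewrite hornerM mulf_neq0.
    - by rewrite !(hornerD, hornerN, hornerM); field; rewrite q0 q'0.
  exists (p * p'), (q * q'); split; [exact: coef_inM|exact: coef_inM| |].
    by rewrite hornerM mulf_neq0.
  by rewrite !hornerM; field; rewrite q0 q'0.
move=> _ [p [q [hp hq q0 ->]]]; rewrite mulf_eq0 negb_or => /andP[p0 _].
by exists q, p; split=> //; rewrite invfM invrK mulrC.
Qed.

End CoefIn.

(** * Hensel's lemma *)

Section Hensel.
Variables (F : fieldType) (w : F -> int).
Hypothesis wP : is_valuation w.

Lemma horner_vge p x : coef_in (vge w ^~ 0) p -> vge w x 0 -> vge w p.[x] 0.
Proof.
move=> + hx; elim/poly_ind: p => [|p c IH]; first by rewrite horner0; left.
move=> /coef_in_cons[/IH hp hc]; rewrite !hornerE.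
by apply: vgeD => //; apply: vgeMl.
Qed.

(** Replaces Taylor expansion in Newton's iteration: [Q] is built along Horner's scheme, and near
    [u] it agrees with the derivative modulo the maximal ideal. *)
Lemma horner_difference_quotient p x y u :
  coef_in (vge w ^~ 0) p -> vge w x 0 -> vge w y 0 -> vge w u 0 ->
  exists Q, [/\ p.[x] - p.[y] = (x - y) * Q, vge w Q 0 &
    vge w (x - u) 1 -> vge w (y - u) 1 -> vge w (Q - p^`().[u]) 1].
Proof.
move=> + hx hy hu; elim/poly_ind: p => [_|p c IH].
  exists 0; rewrite deriv0 !horner0 !subr0 mulr0.
  by split=> [//||_ _]; left.
move=> /coef_in_cons[hp hc]; have [Q [eqQ hQ dQ]] := IH hp.
exists (Q * x + p.[y]); split.
- rewrite !hornerE; transitivity ((p.[x] - p.[y]) * x + p.[y] * (x - y)).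
    by ring.
  by rewrite eqQ; ring.
- by apply: vgeD; [|apply: vgeMl|apply: horner_vge].
move=> xu yu; rewrite derivMXaddC !hornerE.
have -> : Q * x + p.[y] - (p.[u] + p^`().[u] * u) =
    x * (Q - p^`().[u]) + p^`().[u] * (x - u) + (p.[y] - p.[u]) by ring.
have hd : vge w p^`().[u] 0.
  apply: horner_vge => // i; rewrite coef_deriv -mulr_natr mulrC.
  apply: vgeMl (hp _) => //; elim: i.+1 => [|m IHm]; first by left.
  by rewrite mulrS; apply: vgeD => //; right; rewrite val1.
apply: vgeD => //; first apply: vgeD => //.
- by apply: vgeMl => //; apply: dQ.
- exact: vgeMl.
(* It remains to see that [p.[y]] and [p.[u]] are congruent because [y] and [u] are. *)
elim/poly_ind: p hp {IH eqQ dQ hd} => [_|p b IH].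
  by rewrite !horner0 subr0; left.
move=> /coef_in_cons[hp hb]; rewrite !hornerE.
have -> : p.[y] * y + b - (p.[u] * u + b) =
    y * (p.[y] - p.[u]) + p.[u] * (y - u) by ring.
apply: vgeD => //; apply: vgeMl => //; first exact: IH.
exact: horner_vge.
Qed.

Hypothesis w_complete : complete w.

(* Simplified Newton iteration: the slope [p'(u)] is kept fixed, so that
   [x - p(x) / p'(u)] contracts the residue class of [u]. *)
Lemma hensel p u : coef_in (vge w ^~ 0) p -> vge w u 0 -> vge w p.[u] 1 ->
  p^`().[u] != 0 -> w p^`().[u] = 0 -> exists d, p.[d] = 0 /\ vge w (d - u) 1.
Proof.
move=> hp hu pu1 a0 wa; set a := p^`().[u] in a0 wa.
pose x m := iter m (fun y => y - p.[y] / a) u.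
have xS m : x m.+1 = x m - p.[x m] / a by [].
have hV : vge w a^-1 0 by right; rewrite valV // wa.
have inO y : vge w (y - u) 1 -> vge w y 0.
  move=> yu; rewrite -[y](subrK u); apply: vgeD => //.
  exact: vge_weaken yu.
have xu m : vge w (x m - u) 1.
  elim: m => [|m IH]; first by rewrite subrr; left.
  have [Q [eqQ hQ _]] := horner_difference_quotient hp (inO _ IH) hu hu.
  have -> : x m.+1 - u = (x m - u) - a^-1 * (p.[u] + Q * (x m - u)).
    by rewrite xS [Q * _]mulrC -eqQ; ring.
  apply: vgeB => //; apply: vgeMl => //; apply: vgeD => //.
  exact: vgeMl.
have xO m := inO _ (xu m).
have step m : vge w (x m.+1 - x m) m.+1%:Z.
  elim: m => [|m IH].
    have -> : x 1%N - x 0%N = a^-1 * - p.[u] by rewrite xS /=; ring.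
    by apply: vgeMl => //; apply: vgeN.
  have [Q [eqQ hQ dQ]] := horner_difference_quotient hp (xO m.+1) (xO m) hu.
  (* Since [a] and [Q] are congruent modulo the maximal ideal, every iteration gains at least one
     unit of value. *)
  have -> : x m.+2 - x m.+1 = a^-1 * (x m.+1 - x m) * (a - Q).
    transitivity (x m.+1 - x m - (p.[x m.+1] - p.[x m]) / a).
      by rewrite (xS m.+1) {3}[x m.+1]xS; ring.
    by rewrite eqQ; field.
  rewrite -[m.+2]addn1 PoszD; apply: vgeM => //.
    exact: vgeMl.
  by apply: vgeBC => //; apply: dQ.
have tail m j : vge w (x (m + j)%N - x m) m.+1%:Z.
  elim: j => [|j IH]; first by rewrite addn0 subrr; left.
  apply: (vgeB_trans wP) IH; rewrite addnS.
  by apply: vge_weaken (step _); lia.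
have [|d xd] := @w_complete x.
  move=> N; exists `|N|%N => i j hi hj.
  apply: (@vgeB_trans _ _ wP (x `|N|%N)).
    by rewrite -(subnKC hi); apply: vge_weaken (tail _ _); lia.
  apply: vgeBC => //; rewrite -(subnKC hj).
  by apply: vge_weaken (tail _ _); lia.
have du : vge w (d - u) 1.
  have [m hm] := xd 1; apply: (@vgeB_trans _ _ wP (x m)) => //.
  by apply: vgeBC => //; apply: hm.
exists d; split=> //; apply: (vge_eq0 (w := w)) => N.
have [m hm] := xd N; pose M := (m + `|N|)%N.
have [Q [eqQ hQ _]] := horner_difference_quotient hp (xO M) (inO _ du) hu.
(* Both differences tend to zero while [a] and [Q] stay integral. *)
have -> : p.[d] = a * (x M - x M.+1) - Q * (x M - d).
  by rewrite [Q * _]mulrC -eqQ xS; field.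
apply: vgeB => //; last by apply: vgeMl => //; apply: hm; rewrite /M; lia.
apply: vgeMl => //; first by right; rewrite wa.
by apply: vgeBC => //; apply: vge_weaken (step M); rewrite /M; lia.
Qed.

End Hensel.

(** * A maximal trivially valued subfield and its residues *)

Section CoefficientField.
Variables (F : fieldType) (w : F -> int).
Hypothesis wP : is_valuation w.

Definition trivially_valued_subfield (L : F -> Prop) :=
  subfield_of L /\ forall x, L x -> x != 0 -> 0 <= w x.

(** The inequality applies to [x] and to its inverse. *)
Lemma trivially_valued_val L x :
  trivially_valued_subfield L -> L x -> x != 0 -> w x = 0.
Proof.
move=> [LP LO] hx x0; have := LO _ (subfieldV LP hx).
by rewrite invr_eq0 valV // => /(_ x0); have := LO _ hx x0; lia.
Qed.

Lemma trivially_valued_vge L x :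
  trivially_valued_subfield L -> L x -> vge w x 0.
Proof.
move=> LT hx; have [->|x0] := eqVneq x 0; first by left.
by right; rewrite (trivially_valued_val LT).
Qed.

Lemma maximal_trivially_valued L0 : trivially_valued_subfield L0 ->
  exists L, [/\ trivially_valued_subfield L, (forall x, L0 x -> L x) &
    forall L', trivially_valued_subfield L' -> (forall x, L x -> L' x) ->
      forall x, L' x -> L x].
Proof.
move=> L0T.
(* The empty set is admitted because Zorn's lemma also asks for the union of
   the empty chain. *)
pose P (A : set F) := A = set0 \/
  (trivially_valued_subfield A /\ (L0 `<=` A)%classic).
have [C CP Ctot|L [LP Lmax]] := @Zorn_bigcup F P.
  have [[A0 CA0 [y0 A0y0]]|none] :=
      pselect (exists2 A, C A & exists y, A y); last first.
    left; rewrite -subset0 => x [A CA Ax]; apply: none.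
    by exists A => //; exists x.
  have CT A x : C A -> A x ->
      trivially_valued_subfield A /\ (L0 `<=` A)%classic.
    by move=> /CP[->|//].
  have [A0T L0A0] := CT _ _ CA0 A0y0.
  have join x y : (\bigcup_(X in C) X)%classic x ->
      (\bigcup_(X in C) X)%classic y -> exists A, [/\ C A, A x & A y].
    move=> [A CA Ax] [B CB By]; have [AB|BA] := Ctot _ _ CA CB.
      by exists B; split=> //; apply: AB.
    by exists A; split=> //; apply: BA.
  right; split; last by move=> x hx; exists A0 => //; apply: L0A0.
  split; last by move=> x [A CA Ax]; apply: (CT _ _ CA Ax).1.2.
  split; first by exists A0 => //; apply: A0T.1.1.
  split; first by exists A0 => //; apply: A0T.1.2.1.
  split=> [x y /join h /h[A [CA Ax Ay]]|x [A CA Ax] x0].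
    have [[AP _] _] := CT _ _ CA Ax.
    by split; exists A => //; [apply: subfieldB|apply: subfieldM].
  by have [[AP _] _] := CT _ _ CA Ax; exists A => //; apply: subfieldV.
(* The maximal set is not empty, since [L0] would properly contain it. *)
have [L_0|[LT L0L]] := LP.
  case: (Lmax L0); last by right; split.
  rewrite L_0; split; first exact: sub0set.
  by move=> /(_ 0 L0T.1.1).
exists L; split=> // L' L'T LL' x L'x; apply: contrapT => nLx.
apply: (Lmax L'); last by right; split=> // y /L0L /LL'.
by split=> // /(_ x L'x).
Qed.

Variable L : F -> Prop.
Hypothesis LT : trivially_valued_subfield L.
Hypothesis Lmax : forall L', trivially_valued_subfield L' ->
  (forall x, L x -> L' x) -> forall x, L' x -> L x.

(** Every nonzero element of [L(e)] is then a quotient of two units, so [L(e)] is trivially valued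
    and maximality absorbs it. *)
Lemma maximal_adjoin e :
  (forall q, coef_in L q -> q.[e] != 0 -> w q.[e] = 0) -> L e.
Proof.
have LP := LT.1; move=> he; apply: (Lmax (L' := adjoin L e)).
- split; first exact: adjoin_subfield.
  move=> _ [p [q [hp hq q0 ->]]]; rewrite mulf_eq0 negb_or => /andP[p0 _].
  by rewrite valM ?invr_eq0 // valV // !he.
- by move=> x; apply: adjoin_base.
- exact: adjoin_gen.
Qed.

Hypothesis w_complete : complete w.
Hypothesis F_char0 : forall m, m.+1%:R != 0 :> F.

(** If the residue of [u] is transcendental over [L], maximality puts [u] itself in [L]. Otherwise a
    polynomial of least degree vanishing at the residue has a simple root there; Hensel's lemma
    lifts it to [d], and [L(d)] is trivially valued. *)
Lemma maximal_residue u : vge w u 0 -> exists d, L d /\ vge w (u - d) 1.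
Proof.
move=> hu; have LP := LT.1.
have LO q : coef_in L q -> coef_in (vge w ^~ 0) q.
  by move=> hq i; apply: trivially_valued_vge LT _.
have unit_at q : coef_in L q -> ~ vge w q.[u] 1 -> w q.[u] = 0.
  move=> /LO hq nq; have [q0|h] := horner_vge wP hq hu.
    by case: nq; left.
  by have := contra_not (fun h => or_intror h) nq; lia.
pose Q m := exists p, [/\ coef_in L p, p != 0, vge w p.[u] 1 & size p = m].
have [[m0 Qm0]|none] := pselect (exists m, Q m); last first.
  exists u; split; last by rewrite subrr; left.
  apply: maximal_adjoin => q hq q0; apply: unit_at => // qu; apply: none.
  exists (size q), q; split=> //; apply: contraNneq q0 => ->.
  by rewrite horner0.
have exQ : exists m, `[< Q m >] by exists m0; apply/asboolP.
case: (ex_minnP exQ) => m /asboolP[p [hp p0 pu1 sp]] mmin.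
have small q : coef_in L q -> q != 0 -> (size q < size p)%N ->
    q.[u] != 0 /\ w q.[u] = 0.
  move=> hq q0 sq; have nq : ~ vge w q.[u] 1.
    move=> qu; have : (m <= size q)%N.
      by apply: mmin; apply/asboolP; exists q.
    by lia.
  by split; [apply/eqP => h; apply: nq; left|apply: unit_at].
have sp1 : (1 < size p)%N.
  rewrite ltnNge; apply/negP => /size1_polyC pE.
  have c0 : p`_0 != 0 by apply: contraNneq p0 => c0; rewrite pE c0.
  move: pu1; rewrite pE hornerC => /(vge_neq0 c0).
  by rewrite (trivially_valued_val LT).
(* The coefficient at [(size p).-2] is the leading coefficient of [p] times a positive integer,
   nonzero in characteristic 0. *)
have dp0 : p^`() != 0.
  apply: contraTneq isT => /(congr1 (fun q : {poly F} => q`_(size p).-2)).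
  rewrite coef_deriv coef0 -mulr_natr => /eqP.
  rewrite mulf_eq0 (negPf (F_char0 _)) orbF.
  have -> : (size p).-2.+1 = (size p).-1 by lia.
  by rewrite -lead_coefE lead_coef_eq0 (negPf p0).
have [du0 wdu] := small _ (coef_in_deriv LP hp) dp0 (lt_size_deriv p0).
have [d [pd du]] := hensel wP w_complete (LO _ hp) hu pu1 du0 wdu.
exists d; split; last exact: vgeBC.
(* Induction on the degree. Below that of [p], [q.[d]] is congruent to the unit [q.[u]]; otherwise
   cancelling the leading term with a multiple of [p] does not change [q.[d]], as [d] is a root. *)
apply: maximal_adjoin => q; have [s] := ubnP (size q).
elim: s q => // s IH q sq hq qd0.
have q0 : q != 0 by apply: contraNneq qd0 => ->; rewrite horner0.
have [sqp|spq] := ltnP (size q) (size p).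
  have [qu0 wqu] := small _ hq q0 sqp.
  have hd : vge w d 0.
    rewrite -[d](subrK u); apply: vgeD => //; exact: vge_weaken du.
  have [R [eqR hR _]] := horner_difference_quotient wP (LO _ hq) hd hu hu.
  rewrite -wqu; apply: (val_dominant wP qu0 _).2.
  rewrite wqu add0r; apply: vgeBC => //; rewrite eqR mulrC.
  exact: vgeMl.
pose c := lead_coef q / lead_coef p.
pose r := q - c%:P * (p * 'X^(size q - size p)).
have rd : r.[d] = q.[d] by rewrite /r hornerD hornerN !hornerM pd mul0r mulr0 subr0.
rewrite -rd; apply: IH; last by rewrite rd.
  have sq0 : (0 < size q)%N by rewrite size_poly_gt0.
  suff: (size r <= (size q).-1)%N by lia.
  apply/leq_sizeP => j hj; rewrite /r coefB coefCM coefMXn.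
  rewrite ifN; last by rewrite -leqNgt; lia.
  have [->|jne] := eqVneq j (size q).-1.
    have -> : ((size q).-1 - (size q - size p))%N = (size p).-1 by lia.
    by rewrite -!lead_coefE /c divfK ?subrr // lead_coef_eq0.
  have qj : (size q <= j)%N by lia.
  have pj : (size p <= j - (size q - size p))%N by lia.
  by rewrite !nth_default ?mulr0 ?subr0.
apply: coef_inB => //; apply: coef_inM => //; last first.
  by apply: coef_inM => //; apply: coef_in_Xn.
apply: coef_inC => //; apply: subfieldM => //; first exact: hq.
by apply: subfieldV => //; apply: hp.
Qed.

End CoefficientField.

(** * Power series in [t] over the coefficient field *)

Section Closure.
Variables (F : fieldType) (w : F -> int).
Hypothesis wP : is_valuation w.
Variable L : F -> Prop.
Hypothesis LT : trivially_valued_subfield w L.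
Variable t : F.
Hypothesis t0 : t != 0.
Hypothesis wt : 0 < w t.

(* Membership in the closure of [L[t]], that is, in [L[[t]]]. *)
Definition approximable z :=
  forall N : int, exists p, coef_in L p /\ vge w (z - p.[t]) N.

Let LP : subfield_of L := LT.1.

Lemma coef_in_vge p : coef_in L p -> vge w p.[t] 0.
Proof.
move=> hp; apply: horner_vge => //; last by right; lia.
by move=> i; apply: trivially_valued_vge LT _.
Qed.

Lemma approximable_vge z : approximable z -> vge w z 0.
Proof.
move=> /(_ 0)[p [hp zp]]; rewrite -[z](subrK p.[t]).
by apply: vgeD => //; apply: coef_in_vge.
Qed.

Lemma approximable_horner p : coef_in L p -> approximable p.[t].
Proof. by move=> hp N; exists p; rewrite subrr; split=> //; left. Qed.

Lemma approximable_base c : L c -> approximable c.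
Proof. by move=> /(coef_inC LP)/approximable_horner; rewrite hornerC. Qed.

Lemma approximable_gen : approximable t.
Proof. by have := approximable_horner (coef_inX LP); rewrite hornerX. Qed.

Lemma approximableD x y :
  approximable x -> approximable y -> approximable (x + y).
Proof.
move=> hx hy N; have [p [hp xp]] := hx N; have [q [hq yq]] := hy N.
exists (p + q); split; first exact: coef_inD.
by rewrite hornerD opprD addrACA; apply: vgeD.
Qed.

Lemma approximableM x y :
  approximable x -> approximable y -> approximable (x * y).
Proof.
move=> hx hy N; have [p [hp xp]] := hx N; have [q [hq yq]] := hy N.
exists (p * q); split; first exact: coef_inM.
have -> : x * y - (p * q).[t] = y * (x - p.[t]) + p.[t] * (y - q.[t]).
  by rewrite hornerM; ring.
apply: vgeD => //; apply: vgeMl => //; first exact: approximable_vge.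
exact: coef_in_vge.
Qed.

Lemma approximable_lim u l :
  (forall m, approximable (u m)) -> converges_to w u l -> approximable l.
Proof.
move=> hu ul N; have [m hm] := ul N; have [p [hp up]] := hu m N.
exists p; split=> //; apply: (@vgeB_trans _ _ wP (u m)) => //.
by apply: vgeBC => //; apply: hm.
Qed.

(** The lowest nonzero term decides: a nonzero constant term is a unit dominating the multiples of
    [t], and a zero one lets a factor [t] be split off. *)
Lemma val_horner p : coef_in L p -> p.[t] != 0 ->
  exists m, w p.[t] = w t *+ m.
Proof.
elim/poly_ind: p => [|p c IH]; first by rewrite horner0 eqxx.
move=> /coef_in_cons[hp hc]; rewrite !hornerE.
have [->|c0 _] := eqVneq c 0.
  rewrite addr0 mulf_eq0 negb_or => /andP[pt0 _].
  by have [m hm] := IH hp pt0; exists m.+1; rewrite valM // hm mulrSr.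
have wc := trivially_valued_val wP LT hc c0.
exists 0%N; rewrite mulr0n -wc; apply: (val_dominant wP c0 _).2.
rewrite wc add0r opprD addrCA subrr addr0; apply: vgeN => //.
apply: vgeMl => //; first exact: coef_in_vge.
by right; lia.
Qed.

Lemma val_approximable z : approximable z -> z != 0 ->
  exists m, w z = w t *+ m.
Proof.
move=> hz z0; have [p [hp zp]] := hz (w z + 1).
have [pt0 <-] := val_dominant wP z0 zp.
exact: val_horner.
Qed.

Lemma approximable_ps_partial (k : fieldType) n (emb : k -> F)
    (xs : 'I_n -> F) f d :
  (forall c, L (emb c)) -> (forall i, approximable (xs i)) ->
  approximable (ps_partial emb xs f d).
Proof.
move=> hemb hxs; rewrite /ps_partial; elim/big_ind: _.
- exact: approximable_base (subfield0 LP).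
- exact: approximableD.
move=> a _; apply: approximableM; first exact: approximable_base.
elim/big_ind: _.
- exact: approximable_base (subfield1 LP).
- exact: approximableM.
move=> i _; elim: (nat_of_ord (a i)) => [|m IH].
  by rewrite expr0; apply: approximable_base (subfield1 LP).
by rewrite exprS; apply: approximableM.
Qed.

End Closure.

(** * States reachable over a fixed coefficient field *)

Section States.
Variables (F : fieldType) (w : F -> int) (n : nat).
Hypothesis wP : is_valuation w.

Lemma reachable_trans L1 (Y1 : 'I_n -> F) L2 Y2 L3 Y3 :
  reachable w L1 Y1 L2 Y2 -> reachable w L2 Y2 L3 Y3 ->
  reachable w L1 Y1 L3 Y3.
Proof.
move=> r12 r23; elim: r12 r23 => // L Y L' Y' L'' Y'' s _ IH /IH.
exact: reach_step.
Qed.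

Variable L : F -> Prop.
Hypothesis LT : trivially_valued_subfield w L.
Hypothesis F_char0 : forall m, m.+1%:R != 0 :> F.

Let LP : subfield_of L := LT.1.

(* Coefficients of a coordinate change must be nonzero, so [d] is written as a
   sum of two nonzero elements and the other variables are shifted back and
   forth. *)
Lemma reachable_shift L0 (Y : 'I_n -> F) i j d :
  (forall x, L0 x -> L x) -> i != j -> L d ->
  reachable w L0 Y L (fun l => if l == j then Y j - d * Y i else Y l).
Proof.
move=> L0L ij hd.
have N10 : (-1 : F) != 0 by rewrite oppr_eq0 oner_neq0.
have L1 := subfield1 LP; have LN1 := subfieldN LP L1.
(* [a] is 1, except for [d = 1], where [a = -1] and [d - a] is 2, nonzero in characteristic 0. *)
have [a [ha a0 da0]] : exists a, [/\ L a, a != 0 & d - a != 0].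
  have [->|d1] := eqVneq d 1.
    by exists (-1); split=> //; rewrite opprK; apply: (F_char0 1).
  by exists 1; split=> //; rewrite ?oner_neq0 // subr_eq0.
have wL c : L c -> c != 0 -> [/\ L c, c != 0 & w c = 0].
  by move=> hc c0; split=> //; apply: (trivially_valued_val wP LT).
pose c1 (l : 'I_n) := if l == j then a else 1.
pose c2 (l : 'I_n) := if l == j then d - a else -1.
have Lself x : L x -> L x by [].
have c1P l : l != i -> [/\ L (c1 l), c1 l != 0 & w (c1 l) = 0].
  by move=> _; rewrite /c1; case: ifP => _; apply: wL; rewrite ?oner_neq0.
have c2P l : l != i -> [/\ L (c2 l), c2 l != 0 & w (c2 l) = 0].
  by move=> _; rewrite /c2; case: ifP => _; apply: wL => //; apply: subfieldB.
apply: reach_step (CoordChange Y LP L0L LT.2 c1P) _.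
have -> : (fun l => if l == j then Y j - d * Y i else Y l) =
  (fun Z l => if l == i then Z i else Z l - c2 l * Z i)
    (fun l => if l == i then Y i else Y l - c1 l * Y i).
  apply: funext => l /=; rewrite eqxx.
  have [->|li] := eqVneq l i; first by rewrite (negPf ij).
  rewrite /c1 /c2; have [->|_] := eqVneq l j; by ring.
exact: reach_step (CoordChange _ LP Lself LT.2 c2P) (reach_refl _ _ _).
Qed.

Variables (L0 : F -> Prop) (xs : 'I_n -> F).

Definition subring_over (S : F -> Prop) :=
  [/\ forall x, L x -> S x, forall x y, S x -> S y -> S (x + y) &
      forall x y, S x -> S y -> S (x * y)].

(** The last clause says that [xs] lies in [L[Y_1, ..., Y_n]], in a form that passes closure
    properties from [Y] back to [xs]. Shifts may turn a variable into zero, hence [vge]. *)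
Definition good_state (Y : 'I_n -> F) :=
  [/\ reachable w L0 xs L Y, forall j, vge w (Y j) 1 &
      forall S, subring_over S -> (forall j, S (Y j)) -> forall j, S (xs j)].

Lemma good_monoidal Y i j : good_state Y -> i != j -> Y i != 0 ->
  Y j != 0 -> w (Y i) < w (Y j) ->
  good_state (fun l => if l == j then Y j / Y i else Y l).
Proof.
move=> [rY pY gY] ij i0 j0 lt; split.
- apply: reachable_trans rY _.
  exact: reach_step (Monoidal _ ij i0 j0 lt) (reach_refl _ _ _).
- move=> l; case: ifP => // _; right; rewrite valM ?invr_eq0 // valV //; lia.
move=> S SP hS; apply: gY => // l; have := hS l.
have [->|//] := eqVneq l j => hj; have := hS i; rewrite (negPf ij) => hi.
by rewrite -[Y j](divfK i0); case: SP => _ _; apply.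
Qed.

Lemma good_shift Y i j d : good_state Y -> i != j -> L d ->
  good_state (fun l => if l == j then Y j - d * Y i else Y l).
Proof.
move=> [rY pY gY] ij hd; split.
- by apply: reachable_trans rY _; apply: reachable_shift.
- move=> l; case: ifP => // _; apply: vgeB => //; apply: vgeMl => //.
  exact: trivially_valued_vge LT hd.
move=> S SP hS; apply: gY => // l; have := hS l.
have [->|//] := eqVneq l j => hj; have := hS i; rewrite (negPf ij) => hi.
have [SL SD SM] := SP.
by rewrite -[Y j](subrK (d * Y i)); apply: SD => //; apply: SM => //; apply: SL.
Qed.

Hypothesis L_residue :
  forall u, vge w u 0 -> exists d, L d /\ vge w (u - d) 1.

(** Induction on the precision [N]. A variable of value above [w t] is divided by [t], and
    multiplying the approximation of the quotient back by [t] gains precision. At equal values,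
    [d * t] is subtracted first, with [d] representing the residue of [Y j / t]. Both moves keep [t]
    at index [i]. *)
Lemma minimal_variable_approx t i (N : nat) :
  t != 0 -> 0 < w t ->
  (forall Y j, good_state Y -> Y j != 0 -> w t <= w (Y j)) ->
  forall Y j, good_state Y -> Y i = t -> i != j ->
  exists p, coef_in L p /\ vge w (Y j - p.[t]) N.
Proof.
move=> t0 wt tmin; elim: N => [|N IH] Y j gY Yi ij.
  exists 0; split; first exact: coef_inC (subfield0 LP).
  by rewrite horner0 subr0; have [_ /(_ j) + _] := gY; apply: vge_weaken.
have big Z : good_state Z -> Z i = t -> (Z j != 0 -> w t < w (Z j)) ->
    exists p, coef_in L p /\ vge w (Z j - p.[t]) N.+1.
  move=> gZ Zi; have [-> _|Zj0 /(_ isT) lt] := eqVneq (Z j) 0.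
    exists 0; split; first exact: coef_inC (subfield0 LP).
    by rewrite horner0 subr0; left.
  have [||||p [hp]] := IH _ j (good_monoidal gZ ij _ Zj0 _); rewrite ?Zi //.
    by rewrite (negPf ij).
  rewrite eqxx => vp; exists (p * 'X); split.
    by apply: coef_inM => //; apply: coef_inX.
  have -> : Z j - (p * 'X).[t] = (Z j / t - p.[t]) * t.
    by rewrite !hornerE mulrBl divfK.
  rewrite -[N.+1]addn1 PoszD; apply: vgeM => //; right; lia.
have [Yj0|Yj0] := eqVneq (Y j) 0; first by apply: big; rewrite ?Yj0 ?eqxx.
have [lt|] := ltP (w t) (w (Y j)); first exact: big.
(* Minimality leaves only equality of the two values. *)
have := tmin _ _ gY Yj0 => le1 le2.
have [|d [hd ud]] := L_residue (u := Y j / t).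
  by right; rewrite valM ?invr_eq0 // valV //; lia.
have [||p [hp]] := big _ (good_shift gY ij hd).
- by rewrite (negPf ij).
- rewrite eqxx Yi => nz; have : vge w ((Y j / t - d) * t) (1 + w t).
    by apply: vgeM => //; right.
  by rewrite mulrBl divfK // => /(vge_neq0 nz); lia.
rewrite eqxx Yi => vp; exists (p + d%:P * 'X); split.
  apply: coef_inD => //; apply: coef_inM => //; [exact: coef_inC|exact: coef_inX].
have -> // : Y j - (p + d%:P * 'X).[t] = Y j - d * t - p.[t].
by rewrite !hornerE; ring.
Qed.

End States.

(** * The variables as power series *)

Section PowerSeriesVariables.
Variables (k F : fieldType) (n : nat) (emb : {rmorphism k -> F}).
Variable xs : 'I_n -> F.

Definition pseries_var (i : 'I_n) : pseries n k :=
  fun a => (a == [ffun l => (l == i : nat)])%:R.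

(** The bound is [d.+1] because truncation at 0 admits only the exponent 0 and misses the linear
    term. *)
Lemma ps_partial_var i d : ps_partial emb xs (pseries_var i) d.+1 = xs i.
Proof.
pose a0 : {ffun 'I_n -> 'I_d.+2} := [ffun l => inord (l == i)].
have a0E l : a0 l = (l == i) :> nat.
  by rewrite ffunE inordK //; case: (l == i).
rewrite /ps_partial (bigD1 a0) //= [X in _ + X]big1 => [|a aa0]; last first.
  rewrite /pseries_var; case: eqP => [/ffunP eqa|_]; last first.
    by rewrite rmorph0 mul0r.
  case/eqP: aa0; apply/ffunP => l; apply: val_inj => /=.
  by rewrite a0E; have := eqa l; rewrite !ffunE.
have -> : pseries_var i [ffun l => nat_of_ord (a0 l)] = 1.
  rewrite /pseries_var; case: eqP => // -[]; apply/ffunP => l.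
  by rewrite ffunE a0E ffunE.
rewrite addr0 rmorph1 mul1r (bigD1 i) //= a0E eqxx expr1 big1 ?mulr1 // => l li.
by rewrite a0E (negPf li) expr0.
Qed.

Lemma ps_partial0 d : ps_partial emb xs (fun=> 0) d = 0.
Proof. by rewrite /ps_partial big1 // => a _; rewrite rmorph0 mul0r. Qed.

End PowerSeriesVariables.

(** * Existence of a variable of value one *)

Lemma converges_to_eventually_cst (F : fieldType) (w : F -> int) u l :
  (forall m, u m.+1 = l) -> converges_to w u l.
Proof.
by move=> ul N; exists 1%N => -[//|m] _; rewrite ul subrr; left.
Qed.

Lemma emb_trivially_valued (k F : fieldType) (emb : {rmorphism k -> F})
    (w : F -> int) : (forall c, c != 0 -> w (emb c) = 0) ->
  trivially_valued_subfield w (fun x => exists c, x = emb c).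
Proof.
move=> wemb; split=> [|_ [c ->]]; last by rewrite fmorph_eq0 => /wemb->.
split; first by exists 0; rewrite rmorph0.
split; first by exists 1; rewrite rmorph1.
split=> [_ _ [b ->] [c ->]|_ [c ->] _].
  by split; [exists (b - c); rewrite rmorphB|exists (b * c); rewrite rmorphM].
by exists c^-1; rewrite fmorphV.
Qed.

(* F plays \hat K_n, w plays \hat v, iota : k[[X]] -> \hat K_n is the
   canonical embedding (sum of the series, X_i |-> xs i), emb : k -> \hat K_n. *)
Theorem theorem3 (k F : fieldType) (n : nat) (emb : {rmorphism k -> F})
    (w : F -> int) (xs : 'I_n -> F) (iota : pseries n k -> F) :
  (forall p : nat, p \notin [pchar k]) ->
  (1 < n)%N ->
  (* iota f is the value in F of the power series f at X = xs *)
  (forall f, converges_to w (ps_partial emb xs f) (iota f)) ->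
  (* R_n embeds in \hat K_n *)
  (forall f g, iota f = iota g -> forall a, f a = g a) ->
  (* w is a Z-valued valuation on F, trivial on k *)
  is_valuation w ->
  (forall c, c != 0 -> w (emb c) = 0) ->
  (* center of v on R_n is M_n *)
  (forall f : pseries n k, (exists a, f a != 0) ->
     0 <= w (iota f) /\ (0 < w (iota f) <-> f (mono0 n) = 0)) ->
  (* the value group of v on K_n is Z *)
  (forall m : int, exists f g, [/\ iota f != 0, iota g != 0 &
                                   w (iota f) - w (iota g) = m]) ->
  (* F is the completion of K_n with respect to v *)
  complete w ->
  (forall (y : F) (N : int), exists f g,
     iota g != 0 /\ vge w (y - iota f / iota g) N) ->
  exists (L : F -> Prop) (Y : 'I_n -> F) (i : 'I_n),
    [/\ reachable w (fun x => exists c, x = emb c) xs L Y,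
        Y i != 0 & w (Y i) = 1].
Proof.
move=> char0 n_gt1 iotaP iota_inj wP wemb center vgroup w_complete _.
have F_char0 m : m.+1%:R != 0 :> F.
  rewrite -(rmorph_nat emb) fmorph_eq0.
  by apply/negP => /natf0_pchar-/(_ isT)[p]; apply/negP.
have [L [LT kL Lmax]] := maximal_trivially_valued (emb_trivially_valued wemb).
have L_residue := maximal_residue wP LT Lmax w_complete F_char0.
have iota_var i : iota (pseries_var k i) = xs i.
  apply: (converges_to_unique wP (iotaP _)).
  by apply: converges_to_eventually_cst => m; apply: ps_partial_var.
have iota0 : iota (fun=> 0) = 0.
  apply: (converges_to_unique wP (iotaP _)).
  by apply: converges_to_eventually_cst => m; apply: ps_partial0.
have var1 i : pseries_var k i [ffun l => (l == i : nat)] = 1.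
  by rewrite /pseries_var eqxx.
have xs0 i : xs i != 0.
  apply/eqP; rewrite -iota_var -iota0 => /iota_inj/(_ [ffun l => (l == i : nat)]).
  by rewrite var1 => /eqP; rewrite oner_eq0.
have wxs i : 0 < w (xs i).
  have [|_ [_]] := center (pseries_var k i).
    by exists [ffun l => (l == i : nat)]; rewrite var1 oner_neq0.
  rewrite iota_var; apply; rewrite /pseries_var; case: eqP => // /ffunP/(_ i).
  by rewrite !ffunE eqxx.
pose i0 : 'I_n := Ordinal (ltnW n_gt1); pose j0 : 'I_n := Ordinal n_gt1.
have good_xs : good_state w L (fun x => exists c, x = emb c) xs xs.
  split=> [|j|//]; last by right; have := wxs j; lia.
  (* A shift by 0 enlarges the coefficient field from the image of [k] to [L] and leaves the
     variables unchanged; [n_gt1] provides two distinct indices. *)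
  have := @reachable_shift _ _ _ wP _ LT F_char0 _ xs i0 j0 0 kL isT
    (subfield0 LT.1).
  congr reachable; apply: funext => l; case: eqP => // ->.
  by rewrite mul0r subr0.
(* Values of variables are taken as natural numbers so that a least one exists. *)
pose V m := exists Y i, [/\ good_state w L (fun x => exists c, x = emb c) xs Y,
  Y i != 0 & w (Y i) = m%:Z].
have exV : exists m, `[< V m >].
  exists `|w (xs i0)|%N; apply/asboolP; exists xs, i0; split=> //.
  by have := wxs i0; lia.
case: (ex_minnP exV) => m /asboolP[Y [i [gY Yi0 wYi]]] mmin.
have Ypos : 0 < w (Y i).
  by have [_ /(_ i)/(vge_neq0 Yi0) + _] := gY; lia.
exists L, Y, i; split=> //; first by case: gY.
have tmin Z j : good_state w L (fun x => exists c, x = emb c) xs Z ->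
    Z j != 0 -> w (Y i) <= w (Z j).
  move=> gZ Zj0; have [_ /(_ j)/(vge_neq0 Zj0) Zpos _] := gZ.
  have : (m <= `|w (Z j)|)%N.
    by apply: mmin; apply/asboolP; exists Z, j; split=> //; lia.
  by rewrite wYi; lia.
(* The approximable elements form a subring over [L], so it suffices to treat the variables of the
   state [Y]. *)
have xs_approx j : approximable w L (Y i) (xs j).
  have [_ _ /(_ (approximable w L (Y i)))] := gY; apply.
    split; [exact: approximable_base|exact: approximableD|exact: approximableM].
  move=> {}j; have [<-|ij] := eqVneq i j; first exact: approximable_gen.
  move=> N; have [p [hp vp]] := minimal_variable_approx wP LT F_char0 L_residue
    `|N|%N Yi0 Ypos tmin gY erefl ij.
  by exists p; split=> //; apply: vge_weaken vp; lia.
have iota_approx f : approximable w L (Y i) (iota f).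
  apply: (approximable_lim wP) (iotaP f) => d.
  by apply: approximable_ps_partial => // c; apply: kL; exists c.
(* Two series have values differing by 1; both values are multiples of [w (Y i)], which therefore
   divides 1. *)
have [f [g [f0 g0 fg]]] := vgroup 1.
have [a wf] := val_approximable wP LT Yi0 Ypos (iota_approx f) f0.
have [b wg] := val_approximable wP LT Yi0 Ypos (iota_approx g) g0.
have : (w (Y i) %| w (iota f) - w (iota g))%Z.
  by rewrite wf wg -(mulr_natr _ a) -(mulr_natr _ b) -mulrBr dvdz_mulr.
by rewrite fg dvdz1 => /eqP w1; rewrite -(gtz0_abs Ypos) w1.
Qed.
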